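(* Fix $p\ge 1$. There is a constant $C_p>0$ depending only on $p$ such that the following holds. Let $0<\mu\le L$, $\kappa=L/\mu$, $f\in S_{\mu,L}(\mathbb{R}^d)$, let $n\ge 2\sqrt{\kappa}$ be an integer (the computational budget) and let $C\ge 2$ be a constant such that $n/C$ is a positive integer. Run the algorithm M-ASG for $n$ iterations with $\alpha_1=\frac1L$, $n_1=\frac nC$ and, for $k\ge2$, $n_k=2^k\lceil\sqrt{\kappa}\log(2^{p+2})\rceil$ and $\alpha_k=\frac{1}{2^{2k}L}$. Then $$\mathbb{E}[f(x_n)]-f^*\le C_p\left(\exp\Big(-\frac{n}{C\sqrt{\kappa}}\Big)\big(f(x_0^0)-f^*\big)+\frac{\sigma^2}{n\mu}\right),$$ where $x_n$ denotes the iterate of M-ASG after $n$ gradient steps.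
   Context: $S_{\mu,L}(\mathbb{R}^d)$ is the set of continuously differentiable $f:\mathbb{R}^d\to\mathbb{R}$ with $\frac{\mu}{2}\|x-y\|^2\le f(x)-f(y)-\nabla f(y)^\top(x-y)\le\frac L2\|x-y\|^2$ for all $x,y$. $x^*$ is the unique minimizer of $f$, $f^*=f(x^* )$; $\log$ is the natural logarithm. Stochastic oracle with noise level $\sigma\ge0$: each time the algorithm needs a gradient at a query point $z$ (a function of the initial point and of the randomness used in earlier queries), it receives $\tilde\nabla f(z,w)$, where the random variables $w$ used in the different queries are independent, so that $w$ is independent of all the past, and $\mathbb{E}[\tilde\nabla f(z,w)\mid z]=\nabla f(z)$, $\mathbb{E}[\|\tilde\nabla f(z,w)-\nabla f(z)\|^2\mid z]\le\sigma^2$. M-ASG (Multistage Accelerated Stochastic Gradient) with stage lengths $n_k\in\mathbb{N}$ and stepsizes $\alpha_k\in(0,1/L]$, from a deterministic initial point $x_0^0\in\mathbb{R}^d$: for stages $k=1,2,\dots$, let $\beta_k=\frac{1-\sqrt{\mu\alpha_k}}{1+\sqrt{\mu\alpha_k}}$; set $x_0^k=x_1^k=x_{n_{k-1}+1}^{k-1}$ (for $k=1$: $x_0^1=x_1^1=x_0^0$); and for $m=1,\dots,n_k$ set $y_m^k=(1+\beta_k)x_m^k-\beta_k x_{m-1}^k$ and $x_{m+1}^k=y_m^k-\alpha_k\tilde\nabla f(y_m^k,w_m^k)$. Iterate after $n$ gradient steps: $x_0=x_0^0$, $x_n=x^1_{n+1}$ for $1\le n\le n_1$, and for $n>n_1$,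 $x_n=x^k_{m+1}$, where $k\ge2$ is the stage with $N_{k-1}<n\le N_k$, $N_k=\sum_{i=1}^k n_i$, and $m=n-N_{k-1}$. *)

(* Defs.v *)
From HB Require Import structures.
From mathcomp Require Import all_boot all_order all_algebra.
From mathcomp Require Import all_classical all_reals all_analysis.

Set Implicit Arguments.
Unset Strict Implicit.
Unset Printing Implicit Defensive.

Import Order.TTheory GRing.Theory Num.Theory.
Import numFieldNormedType.Exports.

Local Open Scope classical_set_scope.
Local Open Scope ring_scope.

(* The library's norm on ['rV[R]_d] is the sup norm; it is used only for its
   topology and for differentiability, which do not depend on the norm. *)
Definition dot (R : realType) (d : nat) (x y : 'rV[R]_d) : R :=
  \sum_(i < d) x ord0 i * y ord0 i.

Definition enorm (R : realType) (d : nat) (x : 'rV[R]_d) : R :=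
  Num.sqrt (dot x x).

Definition grad (R : realType) (d : nat) (f : 'rV[R]_d -> R) (x : 'rV[R]_d)
    : 'rV[R]_d :=
  \row_(i < d) 'D_(delta_mx ord0 i) f x.

Definition continuously_differentiable (R : realType) (d : nat)
    (f : 'rV[R]_d -> R) : Prop :=
  (forall x, differentiable f x) /\ continuous (grad f).

Definition S_class (R : realType) (d : nat) (mu L : R) (f : 'rV[R]_d -> R)
    : Prop :=
  continuously_differentiable f /\
  forall x y : 'rV[R]_d,
    mu / 2 * enorm (x - y) ^+ 2 <= f x - f y - dot (grad f y) (x - y) /\
    f x - f y - dot (grad f y) (x - y) <= L / 2 * enorm (x - y) ^+ 2.

Definition borelRd (R : realType) (d : nat) :=
  g_sigma_algebraType (@open 'rV[R]_d).

(* [is_cond_exp P X Z Y]: Y is a version of E[X | Z], i.e. of the conditional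
   expectation of X given the sigma-algebra generated by Z. *)
Definition is_cond_exp (R : realType) (dT : measure_display)
    (T : measurableType dT) (P : probability T R) (dV : measure_display)
    (V : measurableType dV) (X : T -> R) (Z : T -> V) (Y : T -> R) : Prop :=
  [/\ P.-integrable setT (EFin \o X),
      P.-integrable setT (EFin \o Y),
      measurable_fun [set: g_sigma_algebra_preimageType Z] Y
    & forall A : set T, g_sigma_algebra_preimage Z A ->
        (\int[P]_(t in A) (X t)%:E = \int[P]_(t in A) (Y t)%:E)%E].

Definition mutually_independent (R : realType) (dT : measure_display)
    (T : measurableType dT) (P : probability T R) (dW : measure_display)
    (W : measurableType dW) (I : eqType) (D : set I) (X : I -> T -> W) : Prop :=
  forall (s : seq I) (B : I -> set W),
    uniq s -> (forall i, i \in s -> D i) -> (forall i, measurable (B i)) ->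
    P (\bigcap_(i in [set` s]) (X i @^-1` B i)) =
    (\prod_(i <- s) P (X i @^-1` B i))%E.

(* D indexes the queries, z i is the (random) point of query i, w i the noise
   used in its answer g (z i) (w i). *)
Definition stochastic_oracle (R : realType) (d : nat) (dT : measure_display)
    (T : measurableType dT) (P : probability T R) (dW : measure_display)
    (W : measurableType dW) (I : eqType) (f : 'rV[R]_d -> R) (sigma : R)
    (g : 'rV[R]_d -> W -> 'rV[R]_d) (D : set I) (z : I -> T -> 'rV[R]_d)
    (w : I -> T -> W) : Prop :=
  [/\ measurable_fun [set: borelRd R d * W]
        (fun q : borelRd R d * W => g q.1 q.2 : borelRd R d),
      forall i, D i -> measurable_fun setT (w i),
      mutually_independent P D w,
      forall i, D i -> forall j : 'I_d,
        is_cond_exp P (fun t => g (z i t) (w i t) ord0 j)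
          (z i : T -> borelRd R d) (fun t => grad f (z i t) ord0 j)
    & forall i, D i -> exists2 V : T -> R,
        is_cond_exp P
          (fun t => enorm (g (z i t) (w i t) - grad f (z i t)) ^+ 2)
          (z i : T -> borelRd R d) V
        & {ae P, forall t, V t <= sigma ^+ 2}].

(* The algorithm, along one realisation of the noise: [w k m] is w_m^k. *)
Section MASG.
Variables (R : realType) (d : nat) (W : Type).
Variables (g : 'rV[R]_d -> W -> 'rV[R]_d) (mu : R) (alpha : nat -> R).
Variables (ns : nat -> nat) (x00 : 'rV[R]_d) (w : nat -> nat -> W).

Definition masg_beta (k : nat) : R :=
  (1 - Num.sqrt (mu * alpha k)) / (1 + Num.sqrt (mu * alpha k)).

Definition masg_extrapolate (k : nat) (xprev x : 'rV[R]_d) : 'rV[R]_d :=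
  (1 + masg_beta k) *: x - masg_beta k *: xprev.

(* The pair (x_m^k, x_{m+1}^k) of stage k started from x_0^k = x_1^k = x. *)
Fixpoint masg_pair (k : nat) (x : 'rV[R]_d) (m : nat) : 'rV[R]_d * 'rV[R]_d :=
  if m is m'.+1 then
    let: (xprev, xcur) := masg_pair k x m' in
    let y := masg_extrapolate k xprev xcur in
    (xcur, y - alpha k *: g y (w k m))
  else (x, x).

(* x_0^k; stages are numbered from 1, the value at k = 0 is unused. *)
Fixpoint masg_start (k : nat) : 'rV[R]_d :=
  match k with
  | k'.+1 => if k' is 0%N then x00
             else (masg_pair k' (masg_start k') (ns k')).2
  | 0%N => x00
  end.

Definition masg_x (k m : nat) : 'rV[R]_d := (masg_pair k (masg_start k) m).1.

Definition masg_y (k m : nat) : 'rV[R]_d :=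
  masg_extrapolate k (masg_x k m.-1) (masg_x k m).

Definition masg_N (k : nat) : nat := (\sum_(1 <= i < k.+1) ns i)%N.

(* Least k with n <= N_k (see [masg_stageP]). *)
Definition masg_stage (n : nat) : nat :=
  find (fun k => n <= masg_N k)%N (iota 0 n.+1).

Definition masg_iter (n : nat) : 'rV[R]_d :=
  if n is 0%N then x00
  else let k := masg_stage n in masg_x k (n - masg_N k.-1).+1.

Lemma masg_pairS k x m :
  (masg_pair k x m).2 = (masg_pair k x m.+1).1.
Proof. by rewrite /=; case: (masg_pair k x m). Qed.

Lemma masg_x_first : masg_x 1 0 = x00.
Proof. by []. Qed.

Lemma masg_x_restart k : (0 < k)%N -> masg_x k.+1 0 = masg_x k (ns k).+1.
Proof. by case: k => // k _; rewrite /masg_x -masg_pairS. Qed.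

Lemma masg_x1 k : masg_x k 1 = masg_x k 0.
Proof. by []. Qed.

Lemma masg_xS k m : (0 < m)%N ->
  masg_x k m.+1 = masg_y k m - alpha k *: g (masg_y k m) (w k m).
Proof.
case: m => // m _; rewrite /masg_y /masg_x -[LHS]masg_pairS /=.
by case: (masg_pair k _ m).
Qed.

Lemma masg_stageP n : (0 < n)%N -> (forall k, (0 < k)%N -> (0 < ns k)%N) ->
  (0 < masg_stage n)%N /\
  (masg_N (masg_stage n).-1 < n <= masg_N (masg_stage n))%N.
Proof.
move=> n0 ns0; have NS k : masg_N k.+1 = (masg_N k + ns k.+1)%N.
  by rewrite /masg_N big_nat_recr.
have Nk k : (k <= masg_N k)%N.
  elim: k => // k ih; by rewrite NS -addn1 leq_add ?ns0 ?addn1.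
have hs : has (fun k => n <= masg_N k)%N (iota 0 n.+1).
  by apply/hasP; exists n; [rewrite mem_iota add0n leq0n ltnS leqnn | exact: Nk].
have lts : (masg_stage n < n.+1)%N.
  by move: hs; rewrite has_find size_iota.
have := nth_find 0%N hs; rewrite -/(masg_stage n) nth_iota// add0n => le2.
have s0 : (0 < masg_stage n)%N.
  by rewrite lt0n; apply/eqP => s0; move: le2; rewrite s0 /masg_N big_geq// leqNgt n0.
split=> //; rewrite le2 andbT ltnNge.
have ltp : ((masg_stage n).-1 < masg_stage n)%N by rewrite ltn_predL.
have := before_find 0%N ltp; rewrite nth_iota ?add0n; last exact: ltn_trans lts.
by move=> ->.
Qed.

End MASG.

(* Main.v *)
Require Import Defs.
From HB Require Import structures.
From mathcomp Require Import all_boot all_order all_algebra.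
From mathcomp Require Import all_classical all_reals all_analysis.
From mathcomp Require Import measurable_realfun ring lra.

(* With q_k = sqrt (mu alpha_k) and v_m = x_{m-1} + (x_m - x_{m-1}) / q_k, the
   Lyapunov function V_m = f(x_m) - f* + mu/2 |v_m - x*|^2 satisfies, pointwise
   in the gradient error e, V_{m+1} <= (1 - q_k) V_m + <u, e> + alpha_k |e|^2
   with u a function of the past.  The noise of a query is independent of the
   past, so the joint law is a product and Tonelli's theorem lets one integrate
   the noise first, with no integrability assumption on the iterates; this gives
   E V_m <= (1 - q_k)^m E V_0 + q_k sigma^2 / mu in each stage.  At a restart
   v = x, hence V <= 2 (f(x) - f* ).  From the second stage on a complete stage
   contracts by 2 * 2^-(p+2) <= 1/4 while q_k is halved, so the error after
   stage k is O(exp (-n_1 / sqrt kappa) (f(x_0) - f* ) +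
   sigma^2 / (2^k sqrt kappa mu)), and n <= 4 (p + 3) 2^k sqrt kappa as long as
   stage k is running. *)

Set Implicit Arguments.
Unset Strict Implicit.
Unset Printing Implicit Defensive.

Import Order.TTheory GRing.Theory Num.Theory.
Import numFieldNormedType.Exports.

Local Open Scope classical_set_scope.
Local Open Scope ring_scope.

(** * Borel row vectors *)

Section borel_rowvector.
Context (R : realType) (d : nat).

Lemma open_borelRd_measurable (U : set 'rV[R]_d) :
  open U -> measurable (U : set (borelRd R d)).
Proof. exact: sub_sigma_algebra. Qed.

Lemma continuous_borelRd_measurable (h : 'rV[R]_d -> R) : continuous h ->
  measurable_fun [set: borelRd R d] (h : borelRd R d -> R).
Proof.
move=> /continuousP ch; apply: (measurability _ (RGenOpens.measurableE R)).
move=> _ [_ [a [b ->] <-]]; rewrite setTI; apply: open_borelRd_measurable.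
exact/ch/interval_open.
Qed.

Lemma coord_borelRd_measurable j :
  measurable_fun [set: borelRd R d] (fun x : borelRd R d => x ord0 j).
Proof.
apply: (@continuous_borelRd_measurable (fun x => x ord0 j)).
exact: coord_continuous.
Qed.

(* Every open set is a countable union of cubes with rational centres. *)
Lemma measurable_fun_borelRd dX (X : measurableType dX)
    (phi : X -> borelRd R d) :
  (forall j, measurable_fun setT (fun x => phi x ord0 j)) ->
  measurable_fun setT phi.
Proof.
move=> mphi; have borelE : @measurable _ (borelRd R d) = <<s @open 'rV[R]_d >> by [].
apply: (measurability _ borelE).
move=> _ [U oU <-]; rewrite setTI.
pose cube (qk : 'rV[rat]_d * nat) : set 'rV[R]_d :=
  [set x | forall j, `|x ord0 j - ratr (qk.1 ord0 j)| < qk.2.+1%:R^-1].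
(* Indexing by [nat] goes through [unpickle]; codes that decode to nothing and cubes that stick out
   of [U] contribute the empty set. *)
pose F k := if unpickle k is Some qk then
  (if `[< cube qk `<=` U >] then cube qk else set0) else set0.
have -> : U = \bigcup_k F k.
  apply/seteqP; split=> [x Ux|x [k _]]; last first.
    by rewrite /F; case: unpickle => // qk; case: asboolP => // + Fx; exact.
  have /nbhs_ballP[e /= e0 eU] : nbhs x U by apply: open_nbhs_nbhs.
  (* Two points of a cube of half-side below [e / 2] differ by less than [e] in each coordinate, so
     a cube containing [x] stays inside the ball. *)
  have [k ke] : exists k, k.+1%:R^-1 < e / 2.
    have [k] := @ltr_add_invr R 0 (e / 2) (divr_gt0 e0 (ltr0Sn _ 1)).
    by rewrite add0r; exists k.
  have k0 : 0 < k.+1%:R^-1 :> R by [].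
  have /fin_all_exists[q qP] (j : 'I_d) : exists q : rat,
      ratr q \in `]x ord0 j - k.+1%:R^-1, x ord0 j + k.+1%:R^-1[.
    by apply: rat_in_itvoo; rewrite ltrBlDr -addrA ltrDl addr_gt0.
  pose qk := (\row_j q j : 'rV[rat]_d, k).
  have cx : cube qk x.
    move=> j /=; rewrite mxE; have := qP j; move: (k.+1%:R^-1) => r.
    by rewrite in_itv/= ltr_norml => /andP[? ?]; apply/andP; split; lra.
  have cU : cube qk `<=` U.
    move=> y cy; apply: eU; split=> // i j; rewrite (ord1 i) /ball/=.
    have := cx j; have := cy j; have := ke; rewrite /= mxE.
    move: (k.+1%:R^-1) => r h0 h1 h2.
    rewrite (le_lt_trans (ler_distD (ratr (q j)) _ _))//.
    by rewrite [X in _ + X]distrC; lra.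
  exists (pickle qk) => //; rewrite /F pickleK.
  by case: asboolP.
rewrite preimage_bigcup; apply: bigcup_measurable => k _.
rewrite /F; case: unpickle => [[q m]|]; last by rewrite preimage_set0.
case: ifP => _; last by rewrite preimage_set0.
rewrite (_ : _ @^-1` _ = \bigcap_(j in [set: 'I_d])
   ((fun x => phi x ord0 j) @^-1` ball (ratr (q ord0 j) : R) m.+1%:R^-1)).
  apply: fin_bigcap_measurable => // j _; rewrite -[X in measurable X]setTI.
  by apply: mphi => //; rewrite ball_itv; exact: measurable_itv.
apply/seteqP; split=> x /= h j; first by move=> _; rewrite /ball/= distrC; exact: h.
by have := h j I; rewrite /ball/= distrC.
Qed.

End borel_rowvector.

Section borel_rowvector_ops.
Context {R : realType} {d : nat} {dX : measure_display} {X : measurableType dX}.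
Implicit Types phi psi : X -> borelRd R d.

Lemma measurable_borelRd_coord phi j : measurable_fun setT phi ->
  measurable_fun setT (fun x => phi x ord0 j).
Proof.
by move=> mphi; apply: (measurableT_comp (@coord_borelRd_measurable R d j)).
Qed.

Lemma measurable_borelRdD phi psi :
  measurable_fun setT phi -> measurable_fun setT psi ->
  measurable_fun setT (fun x => phi x + psi x : borelRd R d).
Proof.
move=> mphi mpsi; apply: measurable_fun_borelRd => j.
under eq_fun do rewrite mxE.
by apply: measurable_funD; exact: measurable_borelRd_coord.
Qed.

Lemma measurable_borelRdZ (c : R) phi : measurable_fun setT phi ->
  measurable_fun setT (fun x => c *: phi x : borelRd R d).
Proof.
move=> mphi; apply: measurable_fun_borelRd => j.
under eq_fun do rewrite mxE.
by apply: measurable_funM => //; exact: measurable_borelRd_coord.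
Qed.

Lemma measurable_borelRdB phi psi :
  measurable_fun setT phi -> measurable_fun setT psi ->
  measurable_fun setT (fun x => phi x - psi x : borelRd R d).
Proof.
move=> mphi mpsi; apply: measurable_borelRdD => //.
under eq_fun do rewrite -scaleN1r.
exact: measurable_borelRdZ.
Qed.

Lemma measurable_dot phi psi :
  measurable_fun setT phi -> measurable_fun setT psi ->
  measurable_fun setT (fun x => dot (phi x) (psi x)).
Proof.
move=> mphi mpsi; apply: measurable_sum => j.
by apply: measurable_funM; exact: measurable_borelRd_coord.
Qed.

End borel_rowvector_ops.

(** * Integration against independent noise *)

(** The bundled form that [distribution] expects, for functions known to be measurable only through
    a proof. *)
Definition mfun_of dT dX (T : measurableType dT) (X : measurableType dX)
    (S : T -> X) (mS : measurable_fun setT S) : {mfun T >-> X} :=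
  MeasurableFun.Pack (MeasurableFun.Class (isMeasurableFun.Build _ _ _ _ _ mS)).

Definition indep_fun (R : realType) dT dX dW (T : measurableType dT)
    (X : measurableType dX) (W : measurableType dW) (P : probability T R)
    (S : T -> X) (v : T -> W) : Prop :=
  forall A B, measurable A -> measurable B ->
    P (S @^-1` A `&` v @^-1` B) = (P (S @^-1` A) * P (v @^-1` B))%E.

Section joint_law.
Local Open Scope ereal_scope.
Context {R : realType} {dT dX dW : measure_display} {T : measurableType dT}
  {X : measurableType dX} {W : measurableType dW} (P : probability T R).
Variables (S : T -> X) (v : T -> W).
Hypotheses (mS : measurable_fun setT S) (mv : measurable_fun setT v).

Let Sv t := (S t, v t).
Let mSv : measurable_fun setT Sv.
Proof. exact: measurable_fun_pair. Qed.

Hypothesis indepSv : indep_fun P S v.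

(** Independence says that the two measures agree on rectangles, and a product measure is determined
    by its values there. *)
Lemma joint_law (C : set (X * W)) : measurable C ->
  pushforward P Sv C =
  (distribution P (mfun_of mS) \x distribution P (mfun_of mv)) C.
Proof.
by move=> mC; rewrite (product_measure_unique (m' := distribution P (mfun_of mSv)))//.
Qed.

(** Both sides are finite measures in [C]: the law of the pair on the event [E], and the law of the
    pair scaled by [P E]. They agree on rectangles, a generating class closed under intersection. In
    the application [E] is an event of later noises. *)
Lemma pair_indep_event (E : set T) : measurable E ->
  (forall A B, measurable A -> measurable B ->
     P (S @^-1` A `&` (v @^-1` B `&` E)) =
     P (S @^-1` A) * (P (v @^-1` B) * P E)) ->
  forall C : set (X * W), measurable C ->
    P (Sv @^-1` C `&` E) = P (Sv @^-1` C) * P E.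
Proof.
move=> mE SvE C mC.
have PE0 : (0 <= fine (P E))%R by exact: fine_ge0.
pose m1 : {measure set (X * W) -> \bar R} :=
  pushforward (mrestr P mE : {measure set T -> \bar R}) Sv.
pose m2 : {measure set (X * W) -> \bar R} :=
  mscale (NngNum PE0) (distribution P (mfun_of mSv)).
have m2E D : m2 D = P (Sv @^-1` D) * P E.
  by rewrite /m2/= /mscale/= fineK ?fin_num_measure// muleC.
suff : m1 mSv C = m2 C by rewrite m2E.
pose G : set (set (X * W)) :=
  [set A `*` B | A in measurable & B in measurable].
apply: (measure_unique G (fun=> setT)) => //.
- exact: measurable_prod_measurableType.
- move=> _ _ [A mA [B mB <-]] [A' mA' [B' mB' <-]].
  exists (A `&` A'); first exact: measurableI.
  exists (B `&` B'); first exact: measurableI.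
  by rewrite setXI.
- by move=> _; exists setT => //; exists setT => //; rewrite setXTT.
- by rewrite bigcup_const//; exists 0%N.
- move=> _ [A mA [B mB <-]]; rewrite m2E.
  have -> : Sv @^-1` (A `*` B) = S @^-1` A `&` v @^-1` B by [].
  rewrite indepSv// -muleA -SvE// setIA.
  by [].
- move=> _; rewrite /m1/= /pushforward/= /mrestr/= preimage_setT setTI.
  by rewrite ltey_eq fin_num_measure.
Qed.

End joint_law.

(** * Fubini under independence, and conditional expectations as fibre integrals *)

Section conditional_mean.
Local Open Scope ereal_scope.
Context {R : realType} {dT dX dW : measure_display} {T : measurableType dT}
  {X : measurableType dX} {W : measurableType dW} (P : probability T R).
Variables (S : T -> X) (v : T -> W).
Hypotheses (mS : measurable_fun setT S) (mv : measurable_fun setT v).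
Hypothesis indepSv : indep_fun P S v.

Let Sv t := (S t, v t).
Let mSv : measurable_fun setT Sv.
Proof. exact: measurable_fun_pair. Qed.
Let PS : probability X R := distribution P (mfun_of mS).
Let Pv : probability W R := distribution P (mfun_of mv).

Lemma ge0_integral_indep (F : X * W -> \bar R) :
  measurable_fun setT F -> (forall q, 0 <= F q) ->
  \int[P]_t F (S t, v t) = \int[PS]_x \int[Pv]_w F (x, w).
Proof.
move=> mF F0; rewrite -[LHS](ge0_integral_pushforward mSv P (D := setT) (f := F))//.
rewrite -[RHS](fubini_tonelli1 F)//.
by apply: eq_measure_integral => A mA _; exact: joint_law.
Qed.

Lemma integrable_indep (F : X * W -> \bar R) : measurable_fun setT F ->
  P.-integrable setT (fun t => F (S t, v t)) ->
  (PS \x Pv).-integrable setT F.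
Proof.
move=> mF /integrableP[_ iF]; apply/integrableP; split=> //.
rewrite (fubini_tonelli1 (fun q => `|F q|))//; last exact: measurableT_comp.
rewrite -[X in X < _](ge0_integral_indep (F := fun q => `|F q|))//.
exact: measurableT_comp.
Qed.

Lemma integral_indep (F : X * W -> \bar R) : measurable_fun setT F ->
  P.-integrable setT (fun t => F (S t, v t)) ->
  \int[P]_t F (S t, v t) = \int[PS]_x \int[Pv]_w F (x, w).
Proof.
move=> mF iF; rewrite -[LHS](integral_pushforward mSv (D := setT) (f := F))//.
rewrite -[RHS]/(\int[PS]_x fubini_F Pv F x).
rewrite integral12_prod_meas1; last exact: integrable_indep.
by apply: eq_measure_integral => A mA _; exact: joint_law.
Qed.

(* Independence upgrades [E[h (S, v) | S] = m S] to the fibrewise statement. *)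
Lemma cond_exp_section (h : X * W -> R) (m : X -> R) :
  measurable_fun setT h -> measurable_fun setT m ->
  is_cond_exp P (fun t => h (S t, v t)) S (fun t => m (S t)) ->
  {ae PS, forall x, Pv.-integrable setT (fun w => (h (x, w))%:E) /\
                    \int[Pv]_w (h (x, w))%:E = (m x)%:E}.
Proof.
move=> mh mm [ih im _ hm].
have mh' : measurable_fun setT (EFin \o h) by exact/measurable_EFinP.
have mm' : measurable_fun setT (EFin \o m) by exact/measurable_EFinP.
have ih2 := integrable_indep mh' ih.
have ae1 := ae_integrable1 ih2.
(* Equal integrals over every measurable [A] force almost sure equality of the fibre mean and
   [m]. *)
have ae2 : ae_eq PS setT (fubini_F Pv (EFin \o h)) (EFin \o m).
  apply: integral_ae_eq => //; first exact: integrable_fubini_F.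
  move=> A _ mA.
  have mSA : measurable (S @^-1` A) by rewrite -[X in measurable X]setTI; exact: mS.
  transitivity (\int[P]_(t in S @^-1` A) (h (S t, v t))%:E).
    rewrite [RHS]integral_mkcond [LHS]integral_mkcond.
    (* Restricting to the event that [S] lies in [A] amounts to cutting off outside a cylinder, so
       the integrand is still a function of the pair. *)
    have mhA : measurable_fun setT ((EFin \o h) \_ (A `*` setT)).
      apply/(measurable_restrictT _ _).1; first exact: measurableX.
      exact: measurable_funTS.
    have E t : ((fun t => (h (S t, v t))%:E) \_ (S @^-1` A)) t =
               ((EFin \o h) \_ (A `*` setT)) (S t, v t).
      rewrite !patchE/=; congr (if _ then _ else _).
      by apply/idP/idP; rewrite !inE/=; [|case].
    under [RHS]eq_integral do rewrite E.
    rewrite integral_indep//; last first.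
      apply: (eq_integrable _ ((fun t => (h (S t, v t))%:E) \_ (S @^-1` A))) => //.
      by apply/(integrable_mkcond _ _).1 => //; exact: integrableS ih.
    apply: eq_integral => x _; rewrite patchE; case: ifPn => xA.
      by apply: eq_integral => w _; rewrite patchE ifT// inE; split=> //=; exact: set_mem.
    rewrite integral0_eq// => w _; rewrite patchE ifF//.
    by apply/negP; rewrite inE => -[/= xA' _]; move: xA; rewrite mem_set.
  rewrite hm; last by exists A => //; rewrite setTI.
  rewrite -(integral_pushforward mS (D := A) (f := EFin \o m))//.
  exact: integrableS im.
move: ae1 ae2; apply: filterS2 => x ? /(_ I) ?; split=> //.
Qed.

End conditional_mean.

(** * Expected decrease over one noisy step *)

Section one_step.
Local Open Scope ereal_scope.
Context {R : realType} {dT dX dW : measure_display} {T : measurableType dT}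
  {X : measurableType dX} {W : measurableType dW} (P : probability T R).
Variables (S : T -> X) (v : T -> W).
Hypotheses (mS : measurable_fun setT S) (mv : measurable_fun setT v).
Hypothesis indepSv : indep_fun P S v.
Let PS : probability X R := distribution P (mfun_of mS).
Let Pv : probability W R := distribution P (mfun_of mv).

(** With the past frozen at [x], the coefficients [u i x] are constants and the linear terms
    integrate to zero over the noise, for almost every [x]. The resulting fibrewise bound is then
    integrated over the law of the past. *)
Lemma expected_decrease (I : finType) (e : I -> X * W -> R) (u : I -> X -> R)
    (V : X -> R) (V' : X * W -> R) (c : R) :
  (forall i, measurable_fun setT (e i)) ->
  (forall i, {ae PS, forall x, Pv.-integrable setT (fun w => (e i (x, w))%:E) /\
                               \int[Pv]_w (e i (x, w))%:E = 0}) ->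
  measurable_fun setT V -> measurable_fun setT V' ->
  (forall x, 0 <= V x)%R -> (forall q, 0 <= V' q)%R -> (0 < c)%R ->
  (forall x w, V' (x, w) <= V x + \sum_i u i x * e i (x, w) +
                            c * \sum_i e i (x, w) ^+ 2)%R ->
  \int[P]_t (V' (S t, v t))%:E <=
  \int[P]_t (V (S t))%:E + c%:E * \int[P]_t (\sum_i e i (S t, v t) ^+ 2)%:E.
Proof.
move=> me e0 mV mV' V0 V'0 c0 dec.
pose H q := (\sum_i e i q ^+ 2)%R.
have H0 q : (0 <= H q)%R by apply: sumr_ge0 => i _; exact: sqr_ge0.
have mH : measurable_fun setT (EFin \o H).
  by apply/measurable_EFinP/measurable_sum => i; exact: measurable_funX.
have mV'' : measurable_fun setT (EFin \o V') by exact/measurable_EFinP.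
have mVE : measurable_fun setT (EFin \o V) by exact/measurable_EFinP.
rewrite (ge0_integral_indep mS mv indepSv (F := EFin \o V'))//.
rewrite (ge0_integral_indep mS mv indepSv (F := EFin \o H))//.
rewrite -[X in _ <= X + _](ge0_integral_distribution (mfun_of mS) mVE)//.
have mFH : measurable_fun setT (fun x => \int[Pv]_w (EFin \o H) (x, w)).
  exact: (measurable_fun_fubini_tonelli_F (m2 := Pv) (EFin \o H)).
have FH0 x : 0 <= \int[Pv]_w (EFin \o H) (x, w).
  by apply: integral_ge0 => w _; rewrite lee_fin.
have cE0 : 0 <= c%:E by rewrite lee_fin ltW.
rewrite -ge0_integralZl//; last by move=> x _; exact: FH0.
rewrite -ge0_integralD//; last 3 first.
- by move=> x _; rewrite lee_fin.
- by move=> x _; exact: (mule_ge0 cE0 (FH0 x)).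
- exact: measurable_funeM.
apply: ae_ge0_le_integral => //.
- by move=> x _; apply: integral_ge0 => w _; rewrite lee_fin.
- exact: (measurable_fun_fubini_tonelli_F (m2 := Pv) (EFin \o V')).
- by move=> x _; rewrite adde_ge0 ?lee_fin//; exact: (mule_ge0 cE0 (FH0 x)).
- by apply: emeasurable_funD => //; exact: measurable_funeM.
(* As [I] is finite, one null set serves all coordinates. *)
have : {ae PS, forall x, forall i, Pv.-integrable setT (fun w => (e i (x, w))%:E) /\
                               \int[Pv]_w (e i (x, w))%:E = 0}.
  by apply: filter_forall => i; exact: e0.
apply: filterS => x ex _.
have mHx : measurable_fun setT (fun w => (H (x, w))%:E).
  exact: (measurable_fun_pair2 x mH).
(* An infinite second moment on the fibre makes the right-hand side infinite, since [0 < c];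
   otherwise every term of the bound is integrable and the integral splits. *)
have [Hoo|Hfin] := eqVneq (\int[Pv]_w (H (x, w))%:E) +oo.
  by rewrite /= Hoo gt0_muley ?lte_fin// addey ?leey.
have iH : Pv.-integrable setT (fun w => (H (x, w))%:E).
  apply/integrableP; split=> //.
  under eq_integral do rewrite gee0_abs ?lee_fin//.
  by rewrite ltey.
have iU : Pv.-integrable setT (fun w => \sum_i (u i x)%:E * (e i (x, w))%:E).
  by apply: integrable_sum => // i _; apply: integrableZl => //; exact: (ex i).1.
pose K w := (V x)%:E + \sum_i (u i x)%:E * (e i (x, w))%:E.
have iV : Pv.-integrable setT (fun w => (V x)%:E) by exact: finite_measure_integrable_cst.
have iK : Pv.-integrable setT K by exact: integrableD.
have iKE : \int[Pv]_w K w = (V x)%:E.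
  rewrite /K integralD// integral_cst//= probability_setT mule1.
  rewrite integral_sum//; last by move=> i; apply: integrableZl => //; exact: (ex i).1.
  rewrite big1 ?adde0// => i _; rewrite integralZl//; last exact: (ex i).1.
  by rewrite (ex i).2 mule0.
rewrite -[X in _ <= X + _]iKE -integralZl// -integralD//; last exact: integrableZl.
apply: ge0_le_integral => //.
- by move=> w _; rewrite lee_fin.
- exact: (measurable_fun_pair2 x mV'').
- by apply: emeasurable_funD; [exact: measurable_int iK|exact: measurable_funeM].
- move=> w _; rewrite /K (eq_bigr (fun i => (u i x * e i (x, w))%:E))//.
  by rewrite sumEFin/= -!EFinD lee_fin; exact: dec.
Qed.

End one_step.

(** * Independence of the state from future noise *)

Section indep_future.
Local Open Scope ereal_scope.
Context {R : realType} {dT dW : measure_display} {T : measurableType dT}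
  {W : measurableType dW} (P : probability T R) {I : eqType}.
Variables (D : set I) (w : I -> T -> W).
Hypothesis mw : forall i, D i -> measurable_fun setT (w i).
Hypothesis indw : mutually_independent P D w.

Let future (s : seq I) (B : I -> set W) : set T :=
  \bigcap_(i in [set` s]) (w i @^-1` B i).

(** Independence from joint events of finitely many noises, not merely from each noise: this form
    survives an update that consumes one of them. *)
Definition indep_future dX (X : measurableType dX) (S : T -> X) (F : set I) :=
  forall (s : seq I) (B : I -> set W) (A : set X),
    uniq s -> (forall i, i \in s -> F i) -> (forall i, measurable (B i)) ->
    measurable A ->
    P (S @^-1` A `&` \bigcap_(i in [set` s]) (w i @^-1` B i)) =
    P (S @^-1` A) * P (\bigcap_(i in [set` s]) (w i @^-1` B i)).

Let future_cons i s B : future (i :: s) B = w i @^-1` B i `&` future s B.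
Proof.
apply/seteqP; split=> [t st|t [wt st] j /=].
  split=> [|j /= js]; first by apply: (st i); rewrite /= mem_head.
  by apply: st; rewrite /= inE js orbT.
by rewrite inE => /predU1P[->//|]; exact: st.
Qed.

Let future_measurable s B : (forall i, i \in s -> D i) ->
  (forall i, measurable (B i)) -> measurable (future s B).
Proof.
move=> sD mB; apply: fin_bigcap_measurable; first exact: finite_seq.
by move=> i /= /sD Di; rewrite -[X in measurable X]setTI; exact: mw.
Qed.

Lemma indep_future_cst dX (X : measurableType dX) (x : X) F :
  indep_future (fun=> x) F.
Proof.
move=> s B A _ _ _ _; rewrite preimage_cst; case: ifP => _.
  by rewrite setTI probability_setT mul1e.
by rewrite set0I measure0 mul0e.
Qed.

Lemma indep_future_comp dX dY (X : measurableType dX) (Y : measurableType dY)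
    (S : T -> X) (phi : X -> Y) (F F' : set I) :
  F' `<=` F -> measurable_fun setT phi -> indep_future S F ->
  indep_future (fun t => phi (S t)) F'.
Proof.
move=> F'F mphi iS s B A us sF mB mA.
apply: (iS s B (phi @^-1` A)) => //; first by move=> i /sF /F'F.
by rewrite -[X in measurable X]setTI; exact: mphi.
Qed.

Lemma indep_future_fun dX (X : measurableType dX) (S : T -> X) F i :
  indep_future S F -> F i -> indep_fun P S (w i).
Proof.
move=> iS Fi A B mA mB; have := iS [:: i] (fun=> B) A.
have -> : [set` [:: i]] = [set i].
  by apply/seteqP; split => j /=; rewrite inE => /eqP.
rewrite bigcap_set1; apply => //.
by move=> j; rewrite inE => /eqP ->.
Qed.

(** The noise [w i] is consumed, so [F'] omits [i]. The old state is independent of the joint event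
    of [w i] and the later noises, and mutual independence factors that event further; this is the
    triple product required by [pair_indep_event]. *)
Lemma indep_future_step dX dY (X : measurableType dX) (Y : measurableType dY)
    (S : T -> X) (phi : X * W -> Y) (F F' : set I) i :
  measurable_fun setT S -> measurable_fun setT phi ->
  F `<=` D -> F' `<=` F -> F i -> ~ F' i ->
  indep_future S F -> indep_future (fun t => phi (S t, w i t)) F'.
Proof.
move=> mS mphi FD F'F Fi F'i iS s B A us sF' mB mA.
have iSi := indep_future_fun iS Fi.
have mv := mw (FD _ Fi).
have nis : i \notin s by apply/negP => /sF'.
apply: (pair_indep_event mS mv iSi (E := future s B) _ _ (C := phi @^-1` A)).
- by apply: future_measurable => // j /sF' /F'F /FD.
- move=> A' B' mA' mB'.
  (* Since [i] is not in [s], the event of [w i] and the later event merge into one cylinder over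
     [i :: s]. *)
  pose B'' j := if j == i then B' else B j.
  have mB'' j : measurable (B'' j) by rewrite /B''; case: ifP.
  have sE : future s B'' = future s B.
    apply: eq_bigcapr => j /= js; rewrite /B'' ifF//.
    by apply: contraNF nis => /eqP <-.
  have uis : uniq (i :: s) by rewrite /= nis.
  have isF j : j \in i :: s -> F j.
    by rewrite inE => /predU1P[->//|/sF' /F'F].
  have := iS (i :: s) B'' A' uis isF mB'' mA'.
  rewrite -/(future _ _) future_cons sE {1 2}/B'' eqxx => ->; congr (_ * _).
  have := indw uis (fun j js => FD _ (isF j js)) mB''.
  rewrite -/(future _ _) future_cons sE big_cons {1 2}/B'' eqxx => ->.
  congr (_ * _); rewrite -sE; apply/esym/indw => //.
  by move=> j /sF' /F'F /FD.
- by rewrite -[X in measurable X]setTI; exact: mphi.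
Qed.

End indep_future.

(** * The Lyapunov inequality *)

Section dot_product.
Context {R : realType} {d : nat}.
Implicit Types (x y z : 'rV[R]_d) (c : R).

Lemma dotC x y : dot x y = dot y x.
Proof. by apply: eq_bigr => i _; rewrite mulrC. Qed.

Lemma dotDl x y z : dot (x + y) z = dot x z + dot y z.
Proof. by rewrite -big_split; apply: eq_bigr => i _; rewrite mxE mulrDl. Qed.

Lemma dotZl c x z : dot (c *: x) z = c * dot x z.
Proof. by rewrite /dot mulr_sumr; apply: eq_bigr => i _; rewrite mxE mulrA. Qed.

Lemma dotNl x z : dot (- x) z = - dot x z.
Proof. by rewrite -scaleN1r dotZl mulN1r. Qed.

Lemma dotDr x y z : dot z (x + y) = dot z x + dot z y.
Proof. by rewrite !(dotC z) dotDl. Qed.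

Lemma dotZr c x z : dot z (c *: x) = c * dot z x.
Proof. by rewrite !(dotC z) dotZl. Qed.

Lemma dotNr x z : dot z (- x) = - dot z x.
Proof. by rewrite !(dotC z) dotNl. Qed.

Definition dotE := (dotDl, dotDr, dotNl, dotNr, dotZl, dotZr).

Lemma dot_ge0 x : 0 <= dot x x.
Proof. by apply: sumr_ge0 => i _; rewrite -expr2 sqr_ge0. Qed.

Lemma sqr_enorm x : enorm x ^+ 2 = dot x x.
Proof. by rewrite sqr_sqrtr// dot_ge0. Qed.

End dot_product.

Section lyapunov.
Context {R : realType} {d : nat}.
Variables (mu L : R) (f : 'rV[R]_d -> R) (xs : 'rV[R]_d).
Hypotheses (mu0 : 0 < mu) (muL : mu <= L) (hf : S_class mu L f).
Hypothesis hxs : forall x, f xs <= f x.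

Lemma S_class_lower x y :
  f y + dot (grad f y) (x - y) + mu / 2 * dot (x - y) (x - y) <= f x.
Proof.
by have [_ /(_ x y)[+ _]] := hf; rewrite sqr_enorm => h; lra.
Qed.

Lemma S_class_upper x y :
  f x <= f y + dot (grad f y) (x - y) + L / 2 * dot (x - y) (x - y).
Proof.
have [_ /(_ x y)[_]] := hf; rewrite sqr_enorm => h; lra.
Qed.

(** A gradient step of length [L^-1] from [xs] would lower [f] by at least [dot G G / (2 * L)], so
    minimality forces [G = 0]. *)
Lemma grad_minimizer x : dot (grad f xs) x = 0.
Proof.
have L0 : 0 < L by exact: lt_le_trans muL.
set G := grad f xs.
have GG : dot G G = 0.
  apply/eqP; rewrite eq_le dot_ge0 andbT.
  have := S_class_upper (xs - L^-1 *: G) xs; have := hxs (xs - L^-1 *: G).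
  rewrite [_ - xs]addrAC subrr sub0r !dotE -/G => h1 h2.
  have : 0 <= - (2 * L)^-1 * dot G G.
    rewrite [X in _ <= X](_ : _ =
      - (L^-1 * dot G G) + L / 2 * (L^-1 * (L^-1 * dot G G))); first by lra.
    by field; rewrite gt_eqF.
  by rewrite mulNr oppr_ge0 pmulr_rle0// invr_gt0 mulr_gt0.
have G0 : G = 0.
  apply/rowP => j; rewrite [RHS]mxE; apply/eqP; rewrite -sqrf_eq0 expr2.
  by move/eqP: GG; rewrite psumr_eq0 => [/allP/(_ j)|i _];
    [rewrite mem_index_enum; exact|rewrite -expr2 sqr_ge0].
by rewrite /dot big1// => i _; rewrite G0 mxE mul0r.
Qed.

Lemma minimizer_quadratic_growth x :
  mu / 2 * dot (x - xs) (x - xs) <= f x - f xs.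
Proof. by have := S_class_lower x xs; rewrite grad_minimizer => h; lra. Qed.

(* [q] stands for [sqrt (mu * alpha)]; [momentum q (x_{m-1}, x_m)] is the
   estimate-sequence point of Nesterov's method. *)
Definition momentum (q : R) (s : 'rV[R]_d * 'rV[R]_d) : 'rV[R]_d :=
  s.1 + q^-1 *: (s.2 - s.1).

Definition lyapunov (q : R) (s : 'rV[R]_d * 'rV[R]_d) : R :=
  f s.2 - f xs + mu / 2 * dot (momentum q s - xs) (momentum q s - xs).

Lemma lyapunov_ge q s : f s.2 - f xs <= lyapunov q s.
Proof. by rewrite lerDl mulr_ge0 ?dot_ge0// divr_ge0// ltW. Qed.

Lemma lyapunov_ge0 q s : 0 <= lyapunov q s.
Proof. by rewrite (le_trans _ (lyapunov_ge _ _))// subr_ge0. Qed.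

Lemma lyapunov_restart q x : lyapunov q (x, x) <= 2 * (f x - f xs).
Proof.
have := minimizer_quadratic_growth x.
by rewrite /lyapunov /momentum/= subrr scaler0 addr0 => h; lra.
Qed.

(** Three inequalities are added: descent from [y] with weight 1, and the strong convexity bounds at
    [xs] and [b] with weights [q] and [1 - q]. The products of [grad f y] with the displacements
    then cancel, and the squared distances leave a term of favourable sign. [A] is the new momentum
    point before the gradient correction, relative to [xs]. *)
Lemma lyapunov_step (q al : R) (a b y G e A : 'rV[R]_d) :
  0 < q -> q <= 1 -> al = q ^+ 2 / mu -> al <= L^-1 ->
  y = (1 + (1 - q) / (1 + q)) *: b - ((1 - q) / (1 + q)) *: a ->
  e = G - grad f y ->
  A = (1 - q) *: (momentum q (a, b) - xs) + q *: (y - xs) ->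
  lyapunov q (b, y - al *: G) <=
    (1 - q) * lyapunov q (a, b) + dot (al *: grad f y - q *: A) e + al * dot e e.
Proof.
move=> q0 q1 alE alL yE eE AE.
have q1' : 1 + q != 0 by rewrite gt_eqF// addr_gt0.
have qn : q != 0 by rewrite gt_eqF.
have mun : mu != 0 by rewrite gt_eqF.
have L0 : 0 < L by exact: lt_le_trans muL.
have al0 : 0 < al by rewrite alE divr_gt0// exprn_gt0.
set p := momentum q (a, b) - xs; set r := y - xs; set h := grad f y.
have GE : G = h + e by rewrite eE addrC subrK.
(* The choice of the coefficient [(1 - q) / (1 + q)] is used here: it makes [y] the mean of [b] and
   the momentum point with weights [1] and [q], normalised by [1 + q]. *)
have byE : b - y = q *: (r - p).
  apply/rowP => i; rewrite /r /p /momentum yE !mxE/=.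
  by field; rewrite q1' qn.
have vE : momentum q (b, y - al *: G) - xs = A - (al / q) *: G.
  apply/rowP => i; rewrite AE /momentum !mxE/= yE !mxE.
  by field; rewrite q1' qn.
have fb := S_class_lower b y.
have fs := S_class_lower xs y.
have fy := S_class_upper (y - al *: G) y.
have xsyE : xs - y = - r by rewrite opprB.
have yyE : y - al *: G - y = - (al *: G) by rewrite addrAC subrr sub0r.
rewrite /lyapunov vE/= -/p.
rewrite byE -/h in fb; rewrite xsyE -/h in fs; rewrite yyE -/h in fy.
have ALE : L * al <= 1 by rewrite mulrC -ler_pdivlMr// mul1r.
have GG0 := dot_ge0 G.
have prpr := dot_ge0 (r - p).
rewrite AE -/p -/r {vE AE byE xsyE yyE yE alL}.
clearbody p r h.
have {fy} fy : f (y - al *: G) <= f y - al * dot h G + al / 2 * dot G G.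
  have : L * al * (al / 2 * dot G G) <= 1 * (al / 2 * dot G G).
    by rewrite ler_wpM2r// mulr_ge0// divr_ge0// ltW.
  move: fy; rewrite !dotE; lra.
have {fb} fb : f y - f b <= q * dot h (p - r).
  have : 0 <= mu / 2 * dot (q *: (r - p)) (q *: (r - p)).
    by rewrite mulr_ge0 ?dot_ge0// divr_ge0// ltW.
  move: fb; rewrite dotZr -(opprB p r) dotNr; lra.
have {fs} fs : f y - f xs <= dot h r - mu / 2 * dot r r.
  by move: fs; rewrite !dotE; lra.
have h1 : q * (f y - f xs) <= q * (dot h r - mu / 2 * dot r r).
  by rewrite ler_wpM2l// ltW.
have h2 : (1 - q) * (f y - f b) <= (1 - q) * (q * dot h (p - r)).
  by rewrite ler_wpM2l// subr_ge0.
have h3 : 0 <= mu / 2 * (q * (1 - q) * dot (r - p) (r - p)).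
  by rewrite !mulr_ge0 ?dot_ge0 ?subr_ge0// ?invr_ge0// ltW.
move: fy h1 h2 h3; rewrite {}GE !dotE.
rewrite ?(dotC e) ?(dotC r p) ?(dotC r h) ?(dotC p h).
set hh := dot h h; set he := dot h e; set ee := dot e e.
set hr := dot h r; set hp := dot h p; set rr := dot r r; set pp := dot p p.
set pr := dot p r; set pe := dot p e; set re := dot r e.
move=> fy h1 h2 h3; rewrite -subr_ge0.
move: {fs fb} (f (y - _)) (f xs) (f b) (f y) fy h1 h2 h3 => fn fs fb fy' h0 h1 h2 h3.
(* The gap is exactly a sum of four nonnegative slacks: descent, [q] times the bound at [xs],
   [1 - q] times the bound at [b], and the convexity defect of the squared norm. *)
rewrite [X in 0 <= X](_ : _ =
  (fy' - al * (hh + he) + al / 2 * (hh + he + (he + ee)) - fn) +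
  (q * (hr - mu / 2 * rr) - q * (fy' - fs)) +
  ((1 - q) * (q * (hp - hr)) - (1 - q) * (fy' - fb)) +
  mu / 2 * (q * (1 - q) * (rr - pr - (pr - pp)))).
  lra.
by rewrite alE; field; rewrite mun qn.
Qed.

End lyapunov.

(** * The M-ASG process *)

Section masg_process.
Context {R : realType} {d : nat} {dT dW : measure_display}
  {T : measurableType dT} {W : measurableType dW} (P : probability T R).
Variables (mu L : R) (f : 'rV[R]_d -> R) (xs : 'rV[R]_d) (sigma : R) (n : nat).
Variables (alpha : nat -> R) (ns : nat -> nat) (x00 : 'rV[R]_d).
Variables (g : 'rV[R]_d -> W -> 'rV[R]_d) (w : nat -> nat -> T -> W).
Hypotheses (mu0 : 0 < mu) (muL : mu <= L) (hf : S_class mu L f).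
Hypothesis hxs : forall x, f xs <= f x.
Hypothesis halpha : forall k, (0 < k)%N -> 0 < alpha k <= L^-1.

(** The oracle is assumed only for queries made within the budget [n]; hence the bounds on
    [masg_N ns k.-1 + m] throughout. *)
Let D := [set q : nat * nat | (1 <= q.1)%N /\ (1 <= q.2 <= ns q.1)%N /\
                            (masg_N ns q.1.-1 + q.2 <= n)%N].
Hypothesis horacle : stochastic_oracle P f sigma g D
  (fun q t => masg_y g mu alpha ns x00 (fun k m => w k m t) q.1 q.2)
  (fun q => w q.1 q.2).

Let X := (borelRd R d * borelRd R d)%type.
Let qk k := Num.sqrt (mu * alpha k).

(** Two consecutive iterates are kept because the next query extrapolates from both; the process is
    then driven by this state and fresh noise alone. *)
Definition masg_state k m t : X :=
  masg_pair g mu alpha (fun k m => w k m t) k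
    (masg_start g mu alpha ns x00 (fun k m => w k m t) k) m.

Let query k (s : X) : borelRd R d := masg_extrapolate mu alpha k s.1 s.2.
Let update k (q : X * W) : X :=
  (q.1.2, query k q.1 - alpha k *: g (query k q.1) q.2).
Let noise k (j : 'I_d) (q : X * W) : R :=
  g (query k q.1) q.2 ord0 j - grad f (query k q.1) ord0 j.

Lemma masg_stateS k m t :
  masg_state k m.+1 t = update k (masg_state k m t, w k m.+1 t).
Proof. by rewrite /masg_state /=; case: masg_pair. Qed.

Lemma masg_y_state k m t :
  masg_y g mu alpha ns x00 (fun k m => w k m t) k m.+1 =
  query k (masg_state k m t).
Proof. by rewrite /masg_y /masg_x -masg_pairS. Qed.

Lemma masg_state_restart k t : (0 < k)%N ->
  masg_state k.+1 0 t =
  ((masg_state k (ns k) t).2, (masg_state k (ns k) t).2).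
Proof. by case: k. Qed.

Lemma S_class_continuous : continuous f.
Proof.
by move=> x; apply: differentiable_continuous; case: hf => -[df _] _; exact: df.
Qed.

Lemma measurable_objective dY (Y : measurableType dY) (phi : Y -> borelRd R d) :
  measurable_fun setT phi -> measurable_fun setT (fun y => f (phi y)).
Proof.
by move=> ?; apply: (measurableT_comp (continuous_borelRd_measurable S_class_continuous)).
Qed.

Lemma measurable_grad j :
  measurable_fun [set: borelRd R d] (fun z : borelRd R d => grad f z ord0 j).
Proof.
apply: (@continuous_borelRd_measurable R d (fun z => grad f z ord0 j)) => z.
apply: (@continuous_comp _ _ _ (grad f) (fun M : 'rV[R]_d => M ord0 j)).
  by case: hf => -[_ +] _; exact.
exact: coord_continuous.
Qed.

Let mgo : measurable_fun [set: borelRd R d * W]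
  (fun q : borelRd R d * W => g q.1 q.2 : borelRd R d).
Proof. by case: horacle. Qed.

Let mquery k : measurable_fun setT (query k).
Proof.
by apply: measurable_borelRdB; apply: measurable_borelRdZ;
  [exact: measurable_snd|exact: measurable_fst].
Qed.

Let mquery1 k : measurable_fun setT (fun q : X * W => (query k q.1, q.2)).
Proof.
apply: measurable_fun_pair; last exact: measurable_snd.
by apply: (measurableT_comp (mquery k)); exact: measurable_fst.
Qed.

Let mgquery k : measurable_fun setT
  (fun q : X * W => g (query k q.1) q.2 : borelRd R d).
Proof. exact: (measurableT_comp mgo (mquery1 k)). Qed.

Let mupdate k : measurable_fun setT (update k).
Proof.
apply: measurable_fun_pair.
  by apply: (measurableT_comp (@measurable_snd _ _ _ _)); exact: measurable_fst.
apply: measurable_borelRdB.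
  by apply: (measurableT_comp (mquery k)); exact: measurable_fst.
by apply: measurable_borelRdZ; exact: mgquery.
Qed.

Let mnoise k j : measurable_fun setT (noise k j).
Proof.
apply: measurable_funB; first exact: measurable_borelRd_coord.
apply: (measurableT_comp (measurable_grad j)).
by apply: (measurableT_comp (mquery k)); exact: measurable_fst.
Qed.

Let mlyap q : measurable_fun [set: X] (lyapunov mu f xs q).
Proof.
apply: measurable_funD.
  by apply: measurable_funB => //; apply: measurable_objective; exact: measurable_snd.
apply: measurable_funM => //; apply: measurable_dot;
  apply: measurable_borelRdB => //; apply: measurable_borelRdD => //;
  by [exact: measurable_fst|apply: measurable_borelRdZ;
     apply: measurable_borelRdB; [exact: measurable_snd|exact: measurable_fst]].
Qed.

(** In the lexicographic order of stage and step, these are the noises that [masg_state k m] has not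
    yet used. *)
Let F k m := [set q | D q /\ ((k < q.1)%N \/ q.1 = k /\ (m < q.2)%N)].

Let D_query k m : (0 < k)%N -> (m < ns k)%N ->
  (masg_N ns k.-1 + m.+1 <= n)%N -> D (k, m.+1).
Proof. by []. Qed.

Let masg_stateP_step k m : (0 < k)%N -> (m < ns k)%N ->
  (masg_N ns k.-1 + m.+1 <= n)%N ->
  measurable_fun setT (masg_state k m) ->
  indep_future P (fun q => w q.1 q.2) (masg_state k m) (F k m) ->
  measurable_fun setT (masg_state k m.+1) /\
  indep_future P (fun q => w q.1 q.2) (masg_state k m.+1) (F k m.+1).
Proof.
move=> k0 mns mn mS iS; have [_ mw indw _ _] := horacle.
have -> : masg_state k m.+1 =
    fun t => update k (masg_state k m t, w k m.+1 t).
  by apply/funext => t; exact: masg_stateS.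
have Dq := D_query k0 mns mn.
split.
  apply: (measurableT_comp (mupdate k)); apply: measurable_fun_pair => //.
  exact: (mw _ Dq).
apply: (indep_future_step mw indw (i := (k, m.+1)) mS (mupdate k) _ _ _ _ iS).
- by move=> q [].
- move=> q [Dq' kq]; split=> //; case: kq => [|[-> /ltnW]]; first by left.
  by right.
- by split=> //; right.
- by move=> [_ /= [|[_]]]; rewrite ltnn.
Qed.

(** Induction on stages, with an inner induction on steps. A restart only duplicates a component of
    the state and consumes no noise, so independence passes through it. *)
Lemma masg_stateP k m : (0 < k)%N -> (m <= ns k)%N ->
  (masg_N ns k.-1 + m <= n)%N ->
  measurable_fun setT (masg_state k m) /\
  indep_future P (fun q => w q.1 q.2) (masg_state k m) (F k m).
Proof.
have within j : (0 < j)%N -> measurable_fun setT (masg_state j 0) ->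
    indep_future P (fun q => w q.1 q.2) (masg_state j 0) (F j 0) ->
    forall i, (i <= ns j)%N -> (masg_N ns j.-1 + i <= n)%N ->
    measurable_fun setT (masg_state j i) /\
    indep_future P (fun q => w q.1 q.2) (masg_state j i) (F j i).
  move=> j0 mS0 iS0; elim=> [//|i IHi] ins iN.
  have [|mS iS] := IHi (ltnW ins).
    by rewrite (leq_trans _ iN)// leq_add2l.
  exact: masg_stateP_step.
case: k => // k _; elim: k m => [|k IHk] m mns mn.
  apply: within => //; last first.
    exact: (indep_future_cst P (fun q => w q.1 q.2) ((x00, x00) : X)).
  exact: (@measurable_cst _ _ T X setT (x00, x00)).
have NS : masg_N ns k.+1 = (masg_N ns k + ns k.+1)%N.
  by rewrite /masg_N big_nat_recr.
have [|mS iS] := IHk _ (leqnn _).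
  by rewrite /= -NS (leq_trans _ mn)// leq_addr.
pose dup (s : X) : X := (s.2, s.2).
have mdup : measurable_fun setT dup by apply: measurable_fun_pair.
have E : masg_state k.+2 0 = fun t => dup (masg_state k.+1 (ns k.+1) t).
  by apply/funext => t; exact: masg_state_restart.
apply: within => //; rewrite E; first exact: measurableT_comp.
apply: indep_future_comp mdup iS => q [Dq kq]; split=> //; left.
by case: kq => [/ltnW//|[-> _]].
Qed.

Let qk_gt0 k : (0 < k)%N -> 0 < qk k.
Proof. by move=> k0; rewrite sqrtr_gt0 mulr_gt0//; case/andP: (halpha k0). Qed.

Let qk_le1 k : (0 < k)%N -> qk k <= 1.
Proof.
move=> k0; have /andP[a0 aL] := halpha k0.
have L0 : 0 < L by exact: lt_le_trans muL.
rewrite -sqrtr1 ler_wsqrtr// (le_trans (ler_wpM2l (ltW mu0) aL))//.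
by rewrite ler_pdivrMr// mul1r.
Qed.

Let alphaE k : (0 < k)%N -> alpha k = qk k ^+ 2 / mu.
Proof.
move=> k0; have /andP[a0 _] := halpha k0.
by rewrite sqr_sqrtr ?mulr_ge0 1?ltW// mulrAC divff ?mul1r// gt_eqF.
Qed.

Let Ly k := lyapunov mu f xs (qk k).

(** The vector paired with the gradient error in [lyapunov_step]; it depends on the past only. *)
Let bias k (s : X) : 'rV[R]_d :=
  alpha k *: grad f (query k s) -
  qk k *: ((1 - qk k) *: (momentum (qk k) s - xs) + qk k *: (query k s - xs)).

Let lyapunov_update k s o : (0 < k)%N ->
  Ly k (update k (s, o)) <=
    (1 - qk k) * Ly k s + \sum_j bias k s ord0 j * noise k j (s, o) +
    alpha k * \sum_j noise k j (s, o) ^+ 2.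
Proof.
case: s => a b k0; have /andP[a0 aL] := halpha k0.
have -> : \sum_j noise k j (a, b, o) ^+ 2 =
    dot (g (query k (a, b)) o - grad f (query k (a, b)))
        (g (query k (a, b)) o - grad f (query k (a, b))).
  by apply: eq_bigr => j _; rewrite /noise !mxE expr2.
have -> : \sum_j bias k (a, b) ord0 j * noise k j (a, b, o) =
    dot (bias k (a, b)) (g (query k (a, b)) o - grad f (query k (a, b))).
  by apply: eq_bigr => j _; congr (_ * _); rewrite /noise !mxE.
exact: (lyapunov_step mu0 muL hf (y := query k (a, b))
  (G := g (query k (a, b)) o) (qk_gt0 k0) (qk_le1 k0) (alphaE k0) aL
  erefl erefl erefl).
Qed.

Lemma masg_oracle k m : (0 < k)%N -> (m < ns k)%N ->
  (masg_N ns k.-1 + m.+1 <= n)%N ->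
  let z t := query k (masg_state k m t) in
  (forall j, is_cond_exp P (fun t => g (z t) (w k m.+1 t) ord0 j)
     (z : T -> borelRd R d) (fun t => grad f (z t) ord0 j)) /\
  exists2 V : T -> R,
    is_cond_exp P (fun t => enorm (g (z t) (w k m.+1 t) - grad f (z t)) ^+ 2)
          (z : T -> borelRd R d) V
        & {ae P, forall t, V t <= sigma ^+ 2}.
Proof.
move=> k0 mns mn z; have Dq := D_query k0 mns mn.
(* The query map is generalised to [z'] because the conditioning sigma-algebra depends on it too, so
   all occurrences must be replaced at once. *)
have [z' [z'E h]] : exists z', z' = z /\
  (forall j, is_cond_exp P (fun t => g (z' t) (w k m.+1 t) ord0 j)
     (z' : T -> borelRd R d) (fun t => grad f (z' t) ord0 j)) /\
  exists2 V : T -> R,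
    is_cond_exp P (fun t => enorm (g (z' t) (w k m.+1 t) - grad f (z' t)) ^+ 2)
          (z' : T -> borelRd R d) V
        & {ae P, forall t, V t <= sigma ^+ 2}.
  exists (fun t => masg_y g mu alpha ns x00 (fun k m => w k m t) k m.+1).
  split; first by apply/funext => t; exact: masg_y_state.
  by have [_ _ _ hm hv] := horacle; split; [exact: hm Dq|exact: hv Dq].
by rewrite -z'E.
Qed.

Lemma masg_expected_step k m : (0 < k)%N -> (m < ns k)%N ->
  (masg_N ns k.-1 + m.+1 <= n)%N ->
  (\int[P]_t (Ly k (masg_state k m.+1 t))%:E <=
   (1 - qk k)%:E * \int[P]_t (Ly k (masg_state k m t))%:E +
   (alpha k * sigma ^+ 2)%:E)%E.
Proof.
move=> k0 mns mn; have [hmean [V hV Vs]] := masg_oracle k0 mns mn.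
have Dq := D_query k0 mns mn.
have [mS iS] := masg_stateP k0 (ltnW mns)
  (leq_trans (leq_add (leqnn _) (leqnSn _)) mn).
have [_ mw indw _ _] := horacle.
have mv : measurable_fun setT (w k m.+1) := mw _ Dq.
have Fq : F k m (k, m.+1) by split=> //; right.
have indSv : indep_fun P (masg_state k m) (w k m.+1) := indep_future_fun iS Fq.
have /andP[a0 _] := halpha k0.
have Ly0 s : 0 <= Ly k s by exact: lyapunov_ge0.
have mLy := mlyap (qk k).
have q1 : 0 <= 1 - qk k by rewrite subr_ge0 qk_le1.
have mz : measurable_fun setT (fun t => query k (masg_state k m t)).
  exact: (measurableT_comp (mquery k)).
have indz : indep_fun P (fun t => query k (masg_state k m t)) (w k m.+1).
  move=> A B mA mB; apply: (indSv (query k @^-1` A) B) => //.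
  by rewrite -[X in measurable X]setTI; exact: mquery.
(* Transport the fibrewise mean from the law of the query point to that of the
   whole state. *)
have noise0 j : {ae distribution P (mfun_of mS), forall s,
    (distribution P (mfun_of mv)).-integrable setT
      (fun o => (noise k j (s, o))%:E) /\
    (\int[distribution P (mfun_of mv)]_o (noise k j (s, o))%:E = 0)%E}.
  have [N [mN N0 NP]] := cond_exp_section mz mv indz
    (measurable_borelRd_coord j mgo) (measurable_grad j) (hmean j).
  exists (query k @^-1` N); split=> //.
    by rewrite -[X in measurable X]setTI; exact: mquery.
  move=> s /= bad; apply: NP => /= good; apply: bad.
  have [ig Eg] := good.
  set Pv := distribution P (mfun_of mv).
  have ic : Pv.-integrable setT (fun=> (grad f (query k s) ord0 j)%:E).
    exact: finite_measure_integrable_cst.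
  have noiseE : (fun o => (noise k j (s, o))%:E) =
      (fun o => (g (query k s) o ord0 j)%:E - (grad f (query k s) ord0 j)%:E)%E.
    by apply/funext => o; rewrite EFinB.
  rewrite noiseE; split; first exact: integrableB.
  rewrite integralB//= [X in (X - _)%E]Eg integral_cst//= probability_setT mule1.
  by rewrite subee.
have H := expected_decrease indSv (u := fun j s => bias k s ord0 j)
  (V := fun s => (1 - qk k) * Ly k s) (V' := fun q => Ly k (update k q))
  (c := alpha k) (mnoise k) noise0 (measurable_funM (measurable_cst _) mLy)
  (measurableT_comp mLy (mupdate k)) (fun s => mulr_ge0 q1 (Ly0 s))
  (fun q => Ly0 _) a0 (fun s o => lyapunov_update s o k0).
under eq_integral do rewrite masg_stateS.
apply: (le_trans H); apply: leeD.
  under eq_integral do rewrite EFinM.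
  rewrite ge0_integralZl//; last by move=> t _; rewrite lee_fin.
  by apply/measurable_EFinP; exact: measurableT_comp.
rewrite EFinM; apply: lee_wpmul2l; first by rewrite lee_fin ltW.
have [iV1 iV2 _ hV'] := hV.
have -> : (\int[P]_t (\sum_j noise k j (masg_state k m t, w k m.+1 t) ^+ 2)%:E =
   \int[P]_t (V t)%:E)%E.
  rewrite -(hV' setT); last by exists setT => //; rewrite setTI.
  apply: eq_integral => t _; congr EFin; rewrite sqr_enorm.
  by apply: eq_bigr => j _; rewrite /noise !mxE expr2.
have sE : (\int[P]_t (sigma ^+ 2)%:E = (sigma ^+ 2)%:E)%E.
  by rewrite integral_cst//= probability_setT mule1.
(* [V] is only a version of the conditional variance and may be negative somewhere; its positive
   part suits the almost-everywhere comparison of nonnegative functions. *)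
have iV2p : P.-integrable setT (fun t => maxe (V t)%:E 0).
  by have := integrable_funepos measurableT iV2; rewrite funepos.unlock.
apply: (@le_trans _ _ (\int[P]_t maxe (V t)%:E 0)%E).
  by apply: le_integral => // t _; rewrite le_max lexx.
rewrite -[X in (_ <= X)%E]sE.
apply: ae_ge0_le_integral => //.
- by move=> t _; rewrite le_max lexx orbT.
- exact: measurable_int iV2p.
- by move=> t _; rewrite lee_fin sqr_ge0.
by move: Vs; apply: filterS => t Vt _; rewrite ge_max !lee_fin Vt sqr_ge0.
Qed.

Let EV k m := (\int[P]_t (Ly k (masg_state k m t))%:E)%E.

Let measurable_Ly k m : (0 < k)%N -> (m <= ns k)%N ->
  (masg_N ns k.-1 + m <= n)%N ->
  measurable_fun setT (fun t => (Ly k (masg_state k m t))%:E).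
Proof.
move=> k0 mns mn; apply/measurable_EFinP.
exact: (measurableT_comp (mlyap (qk k)) (masg_stateP k0 mns mn).1).
Qed.

(** Since [alpha k] equals [qk k ^+ 2 / mu], the noise term [qk k * (sigma ^+ 2 / mu)] is the fixed
    point of the one-step recursion. *)
Lemma masg_stage_bound k m (a : R) : (0 < k)%N -> (m <= ns k)%N ->
  (masg_N ns k.-1 + m <= n)%N -> (EV k 0 <= a%:E)%E ->
  (EV k m <= ((1 - qk k) ^+ m * a + qk k * (sigma ^+ 2 / mu))%:E)%E.
Proof.
move=> k0 mns mn EV0; elim: m mns mn => [|m IHm] mns mn.
  rewrite (le_trans EV0)// lee_fin expr0 mul1r lerDl.
  by rewrite mulr_ge0 ?divr_ge0 ?sqr_ge0// ltW// qk_gt0.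
have := IHm (ltnW mns) (leq_trans (leq_add (leqnn _) (leqnSn _)) mn).
have q1 : (0 <= (1 - qk k)%:E)%E by rewrite lee_fin subr_ge0 qk_le1.
move=> /(lee_wpmul2l q1) le1.
apply: (le_trans (masg_expected_step k0 mns mn)).
apply: (le_trans (leeD le1 (lexx _))).
rewrite -EFinM -EFinD lee_fin [X in X + _ <= _](_ : _ =
  (1 - qk k) ^+ m.+1 * a + (1 - qk k) * (qk k * (sigma ^+ 2 / mu))).
  rewrite (alphaE k0); move: (qk k) => q.
  rewrite le_eqVlt; apply/orP; left; apply/eqP.
  by field; rewrite gt_eqF.
by rewrite mulrDr mulrA -exprS.
Qed.

(** The Lyapunov function changes its parameter between stages; the passage goes through the gap in
    [f], which does not depend on that parameter. *)
Lemma masg_restart_bound k (a : R) : (0 < k)%N -> (masg_N ns k <= n)%N ->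
  (EV k (ns k) <= a%:E)%E -> (EV k.+1 0 <= (2 * a)%:E)%E.
Proof.
move=> k0 kn EVk.
have kn' : (masg_N ns k.-1 + ns k <= n)%N.
  by case: k k0 kn {EVk} => // k _; rewrite /masg_N big_nat_recr.
apply: (@le_trans _ _ (2%:E * EV k (ns k))%E); last first.
  by rewrite EFinM lee_wpmul2l// lee_fin.
rewrite /EV -ge0_integralZl//; last 2 first.
- exact: measurable_Ly.
- by move=> t _; rewrite lee_fin lyapunov_ge0.
apply: ge0_le_integral => //.
- by move=> t _; rewrite lee_fin lyapunov_ge0.
- by apply: measurable_Ly => //; rewrite addn0.
- by apply: measurable_funeM; exact: measurable_Ly.
move=> t _; rewrite -EFinM lee_fin masg_state_restart//.
rewrite (le_trans (lyapunov_restart mu0 muL hf hxs _ _))// ler_wpM2l//.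
exact: lyapunov_ge.
Qed.

Lemma masg_first_bound : (EV 1 0 <= (2 * (f x00 - f xs))%:E)%E.
Proof.
rewrite /EV (_ : (fun t => _) = fun=> (Ly 1 (x00, x00))%:E)//.
rewrite integral_cst//= probability_setT mule1 lee_fin.
exact: (lyapunov_restart mu0 muL hf hxs).
Qed.

(** The finite bound makes the nonnegative gap [h] integrable, which allows the constant [f xs] to
    be taken out of the expectation. *)
Lemma masg_expectation_bound k m (a : R) : (0 < k)%N -> (m <= ns k)%N ->
  (masg_N ns k.-1 + m <= n)%N -> (EV k m <= a%:E)%E ->
  ('E_P[fun t => f (masg_state k m t).2] - (f xs)%:E <= a%:E)%E.
Proof.
move=> k0 mns mn EVa; have [mS _] := masg_stateP k0 mns mn.
pose h t := f (masg_state k m t).2 - f xs.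
have mh : measurable_fun setT h.
  apply: measurable_funB => //; apply: measurable_objective.
  exact: (measurableT_comp measurable_snd mS).
have h0 t : 0 <= h t by rewrite subr_ge0.
have ha : (\int[P]_t (h t)%:E <= a%:E)%E.
  apply: le_trans EVa; apply: ge0_le_integral => //.
  - by move=> t _; rewrite lee_fin.
  - exact/measurable_EFinP.
  - exact: measurable_Ly.
  - by move=> t _; rewrite lee_fin; exact: lyapunov_ge.
have ih : P.-integrable setT (EFin \o h).
  apply/integrableP; split; first exact/measurable_EFinP.
  under eq_integral do rewrite gee0_abs ?lee_fin//.
  exact: le_lt_trans ha (ltry _).
have ic : P.-integrable setT (fun=> (f xs)%:E).
  exact: finite_measure_integrable_cst.
rewrite unlock.
have -> : (\int[P]_t (f (masg_state k m t).2)%:E =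
    \int[P]_t ((h t)%:E + (f xs)%:E))%E.
  by apply: eq_integral => t _; rewrite -EFinD subrK.
rewrite integralD// integral_cst//= probability_setT mule1.
by rewrite addeK.
Qed.

(** * Error recursion across the stages of the prescribed schedule *)

Variables (s : R) (c0 : nat).
Hypotheses (s0 : 0 < s) (hq1 : qk 1 = s^-1).
Hypothesis hq : forall k, (2 <= k)%N -> qk k = (2 ^+ k * s)^-1.
Hypothesis hns : forall k, (2 <= k)%N -> ns k = (2 ^ k * c0)%N.
Hypothesis hc0 : expR (- (c0%:R / s)) <= 8^-1.

Let Delta := f x00 - f xs.
Let E1 := expR (- ((ns 1)%:R / s)).

Let decay k m : (0 < k)%N -> (1 - qk k) ^+ m <= expR (- (m%:R * qk k)).
Proof.
move=> k0; rewrite -mulrN expRM_natl lerXn2r ?nnegrE ?expR_ge0//.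
  by rewrite subr_ge0 qk_le1.
exact: expR_ge1Dx.
Qed.

(** The noise coefficient 2 reproduces itself. In terms of the new [qk], the old noise term has
    coefficient 4, the restart makes it 8, the contraction by [8^-1] leaves 1, and the stage adds
    1. *)
Lemma masg_stage_end k : (0 < k)%N -> (masg_N ns k <= n)%N ->
  (EV k (ns k) <= (2 * E1 * Delta + 2 * (sigma ^+ 2 / mu) * (2 ^+ k * s)^-1)%:E)%E.
Proof.
have D0 : 0 <= Delta by rewrite subr_ge0.
have V0 : 0 <= sigma ^+ 2 / mu by rewrite divr_ge0 ?sqr_ge0// ltW.
have E10 : 0 <= E1 by exact: expR_ge0.
have NS k' : masg_N ns k'.+1 = (masg_N ns k' + ns k'.+1)%N.
  by rewrite /masg_N big_nat_recr.
case: k => // k _; elim: k => [|k IHk] kn.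
  apply: (le_trans (masg_stage_bound _ _ _ masg_first_bound)) => //.
    by rewrite /= -NS.
  (* For the first stage [2 * (2 * s)^-1] is [s^-1 = qk 1], so the uniform formula holds although
     [qk 1] is not [(2 * s)^-1]. *)
  have := decay (ns 1) (ltn0Sn 0); rewrite hq1 -/E1 => d1.
  rewrite lee_fin -/Delta expr1 invfM; set V := sigma ^+ 2 / mu.
  have := ler_wpM2r D0 d1; move: ((1 - s^-1) ^+ ns 1) (s^-1) => x y; lra.
have k0 : (0 < k.+1)%N by [].
have kn1 : (masg_N ns k.+1 <= n)%N.
  by apply: leq_trans kn; rewrite [X in (_ <= X)%N]NS leq_addr.
have le0 := masg_restart_bound k0 kn1 (IHk kn1).
apply: (le_trans (masg_stage_bound _ _ _ le0)) => //.
  by rewrite /= -NS.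
have q_ge0 := ltW (qk_gt0 (ltn0Sn k.+1)).
(* The factors [2 ^+ k] in stage length and stepsize cancel, so every later stage has the same
   exponent [c0 / s]. *)
have contr : (1 - qk k.+2) ^+ ns k.+2 <= 8^-1.
  apply: (le_trans (decay _ _)) => //; apply: le_trans hc0.
  rewrite hns// hq// natrM natrX; set y := 2 ^+ _.
  have y0 : y != 0 by rewrite gt_eqF// exprn_gt0.
  rewrite [X in expR X](_ : _ = - (c0%:R / s))//.
  by field; rewrite y0 gt_eqF.
rewrite lee_fin hq//; move: (sigma ^+ 2 / mu) V0 => V V0.
have -> : (2 ^+ k.+1 * s)^-1 = 2 * (2 ^+ k.+2 * s)^-1.
  rewrite [2 ^+ k.+2]exprS; set y := 2 ^+ _.
  have y0 : y != 0 by rewrite gt_eqF// exprn_gt0.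
  by field; rewrite y0 gt_eqF.
set u := (2 ^+ k.+2 * s)^-1.
have u0 : 0 <= u by rewrite invr_ge0 mulr_ge0 ?exprn_ge0// ltW.
have b0 : 0 <= 2 * (2 * E1 * Delta + 2 * V * (2 * u)).
  by apply: mulr_ge0 => //; apply: addr_ge0; rewrite !mulr_ge0.
have := ler_wpM2r b0 contr; rewrite hq// -/u.
have ED0 : 0 <= E1 * Delta by rewrite mulr_ge0.
have Vu0 : 0 <= V * u by rewrite mulr_ge0.
move: ((1 - u) ^+ ns k.+2) => x; lra.
Qed.

(** The budget may end anywhere inside a stage, so the contraction factor is bounded by 1 only: the
    restart gives 4 and 8, and the running stage adds 1 to the noise coefficient. *)
Lemma masg_in_stage k m : (2 <= k)%N -> (m <= ns k)%N ->
  (masg_N ns k.-1 + m <= n)%N ->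
  (EV k m <= (4 * E1 * Delta + 9 * (sigma ^+ 2 / mu) * (2 ^+ k * s)^-1)%:E)%E.
Proof.
case: k => [//|[//|k]] _ mns mn.
have D0 : 0 <= Delta by rewrite subr_ge0.
have V0 : 0 <= sigma ^+ 2 / mu by rewrite divr_ge0 ?sqr_ge0// ltW.
have E10 : 0 <= E1 by exact: expR_ge0.
have kn1 : (masg_N ns k.+1 <= n)%N by apply: leq_trans mn; exact: leq_addr.
have le0 := masg_restart_bound (ltn0Sn _) kn1 (masg_stage_end (ltn0Sn _) kn1).
apply: (le_trans (masg_stage_bound _ _ _ le0)) => //.
rewrite lee_fin hq//; move: (sigma ^+ 2 / mu) V0 => V V0.
have -> : (2 ^+ k.+1 * s)^-1 = 2 * (2 ^+ k.+2 * s)^-1.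
  rewrite [2 ^+ k.+2]exprS; set y := 2 ^+ _.
  have y0 : y != 0 by rewrite gt_eqF// exprn_gt0.
  by field; rewrite y0 gt_eqF.
set u := (2 ^+ k.+2 * s)^-1.
have u0 : 0 <= u by rewrite invr_ge0 mulr_ge0 ?exprn_ge0// ltW.
have b0 : 0 <= 2 * (2 * E1 * Delta + 2 * V * (2 * u)).
  by apply: mulr_ge0 => //; apply: addr_ge0; rewrite !mulr_ge0.
have qle1 : (1 - u) ^+ m <= 1.
  by rewrite /u -hq// exprn_ile1// ?subr_ge0 ?qk_le1// lerBlDr lerDl ltW// qk_gt0.
have := ler_wpM2r b0 qle1.
have ED0 : 0 <= E1 * Delta by rewrite mulr_ge0.
have Vu0 : 0 <= V * u by rewrite mulr_ge0.
move: ((1 - u) ^+ m) => x; lra.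
Qed.

End masg_process.

(** * Verification of the schedule and final constants *)

Theorem corollary3p8 (R : realType) (p : R) (hp : 1 <= p) :
  exists Cp : R, 0 < Cp /\
  forall (d : nat) (mu L : R) (hmu : 0 < mu) (hmuL : mu <= L)
    (f : 'rV[R]_d -> R) (hf : S_class mu L f)
    (xs : 'rV[R]_d) (hxs : forall x, f xs <= f x)
    (sigma : R) (hsigma : 0 <= sigma)
    (n : nat) (hn : 2 * Num.sqrt (L / mu) <= n%:R)
    (C : R) (hC : 2 <= C)
    (alpha : nat -> R) (ns : nat -> nat)
    (hns1 : (0 < ns 1)%N /\ (ns 1%N)%:R = n%:R / C)
    (halpha1 : alpha 1%N = L^-1)
    (hns : forall k : nat, (2 <= k)%N ->
       (ns k)%:Z =
         2 ^+ k * Num.ceil (Num.sqrt (L / mu) * ln (2 `^ (p + 2))))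
    (halpha : forall k : nat, (2 <= k)%N -> alpha k = (2 ^+ (2 * k)%N * L)^-1)
    (x00 : 'rV[R]_d)
    (dT : measure_display) (T : measurableType dT) (P : probability T R)
    (dW : measure_display) (W : measurableType dW)
    (g : 'rV[R]_d -> W -> 'rV[R]_d) (w : nat -> nat -> T -> W)
    (horacle : stochastic_oracle P f sigma g
       [set q : nat * nat | (1 <= q.1)%N /\ (1 <= q.2 <= ns q.1)%N /\
                            (masg_N ns q.1.-1 + q.2 <= n)%N]
       (fun q t => masg_y g mu alpha ns x00 (fun k m => w k m t) q.1 q.2)
       (fun q => w q.1 q.2)),
  ('E_P[fun t => f (masg_iter g mu alpha ns x00 (fun k m => w k m t) n)]
     - (f xs)%:E
   <= (Cp * (expR (- (n%:R / (C * Num.sqrt (L / mu)))) * (f x00 - f xs)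
             + sigma ^+ 2 / (n%:R * mu)))%:E)%E.
Proof.
(* The 36 is 9 from [masg_in_stage] times 4 from the bound [nle] on [n]. *)
exists (36 * (p + 3)); split; first by lra.
move=> d mu L mu0 muL f hf xs hxs sigma sigma0 n hn C C2 alpha ns [ns1 ns1E] al1.
move=> hns hal x00 dT T P dW W g w horacle.
have L0 : 0 < L by exact: lt_le_trans muL.
set s := Num.sqrt (L / mu) in hn hns *.
have s1 : 1 <= s by rewrite -sqrtr1 ler_wsqrtr// ler_pdivlMr// mul1r.
have s0 : 0 < s by exact: lt_le_trans s1.
have n0 : (0 < n)%N by rewrite -(ltr_nat R) (lt_le_trans _ hn)// mulr_gt0.
set ell := ln (2 `^ (p + 2)) in hns.
have pow8 : 8 <= 2 `^ (p + 2) :> R.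
  rewrite [8](_ : _ = 2 `^ 3%:R); first by rewrite ler_powR ?ler1n//; lra.
  by rewrite powR_mulrn// -natrX.
have ell_le : ell <= p + 2.
  have ln2 : ln (2 : R) <= 1 by rewrite (_ : 2 = 1 + 1)// le_ln1Dx.
  by rewrite /ell ln_powR ler_piMr//; lra.
have ell0 : 0 < ell by rewrite ln_gt0//; lra.
pose c0 := `|Num.ceil (s * ell)|%N.
have ceil0 : 0 < Num.ceil (s * ell) by rewrite ceil_gt0 mulr_gt0.
have c0Z : c0%:Z = Num.ceil (s * ell) by rewrite /c0 gez0_abs// ltW.
have c0_ge : s * ell <= c0%:R.
  by rewrite -[c0%:R]/((c0%:Z)%:~R) c0Z ceil_ge.
(* The 1 lost to the ceiling is absorbed by [1 <= s]. *)
have c0_le : c0%:R <= s * (p + 3).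
  have : c0%:R < s * ell + 1.
    rewrite -[c0%:R]/((c0%:Z)%:~R) c0Z.
    by have := ceilB1_lt (s * ell); rewrite intrB ltrBlDr.
  have : s * ell <= s * (p + 2) by rewrite ler_wpM2l// ltW.
  lra.
have c00 : (0 < c0)%N by rewrite -ltz_nat c0Z.
have nsE k : (2 <= k)%N -> ns k = (2 ^ k * c0)%N.
  by move=> k2; apply/eqP; rewrite -eqz_nat hns// PoszM c0Z -natz natrX.
have ns_gt0 k : (0 < k)%N -> (0 < ns k)%N.
  by case: k => [//|[//|k]] _; rewrite nsE// muln_gt0 expn_gt0.
have halpha k : (0 < k)%N -> 0 < alpha k <= L^-1.
  case: k => [//|[_|k _]]; first by rewrite al1 invr_gt0 L0 lexx.
  have yL : 0 < 2 ^+ (2 * k.+2)%N * L by rewrite mulr_gt0// exprn_gt0.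
  rewrite hal// invr_gt0 yL lef_pV2 ?posrE//=.
  by rewrite ler_peMl ?exprn_ege1 ?ler1n// ltW.
have hq1 : Num.sqrt (mu * alpha 1%N) = s^-1.
  by rewrite al1 -sqrtrV ?divr_ge0 ?ltW// invf_div.
have hq k : (2 <= k)%N -> Num.sqrt (mu * alpha k) = (2 ^+ k * s)^-1.
  move=> k2; rewrite hal//.
  have y0 : 0 <= 2 ^+ k :> R by rewrite exprn_ge0.
  rewrite -[X in X * s](ger0_norm y0) -sqrtr_sqr -sqrtrM ?sqr_ge0//.
  rewrite -sqrtrV; last by rewrite mulr_ge0 ?sqr_ge0// divr_ge0 ?ltW.
  by congr Num.sqrt; rewrite mulnC exprM !invfM invrK; ring.
have hc0 : expR (- (c0%:R / s)) <= 8^-1.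
  apply: (@le_trans _ _ (expR (- ell))).
    by rewrite ler_expR lerN2 ler_pdivlMr// mulrC.
  by rewrite expRN lnK ?posrE ?powR_gt0// lef_pV2 ?posrE ?powR_gt0.
have [k0 /andP[Nk1 Nk]] := masg_stageP n0 ns_gt0.
set k := masg_stage ns n in k0 Nk1 Nk.
have NS j : masg_N ns j.+1 = (masg_N ns j + ns j.+1)%N.
  by rewrite /masg_N big_nat_recr.
have nC : n%:R / C <= n%:R / 2.
  by rewrite ler_wpM2l// lef_pV2// posrE; lra.
have nR : 0 < n%:R :> R by rewrite ltr0n.
(* The first stage uses at most half of the budget, so the last iterate lies in a later stage. *)
have k2 : (2 <= k)%N.
  rewrite ltn_neqAle k0 andbT; apply/eqP => k1.
  move: Nk; rewrite -k1 NS /masg_N big_geq// add0n -(ler_nat R) ns1E.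
  lra.
pose m := (n - masg_N ns k.-1)%N.
have mn : (masg_N ns k.-1 + m = n)%N by rewrite subnKC// ltnW.
have mns : (m <= ns k)%N.
  by rewrite leq_subLR; move: Nk; rewrite -{1}(prednK k0) NS prednK.
have iterE t : masg_iter g mu alpha ns x00 (fun k m => w k m t) n =
    (masg_state mu alpha ns x00 g w k m t).2.
  have -> : masg_iter g mu alpha ns x00 (fun k m => w k m t) n =
      masg_x g mu alpha ns x00 (fun k m => w k m t) k m.+1.
    by rewrite /masg_iter /m /k; case: (n) n0.
  by rewrite /masg_x -masg_pairS.
have mn' : (masg_N ns k.-1 + m <= n)%N by rewrite mn.
under eq_fun do rewrite iterE.
apply: (le_trans (masg_expectation_bound mu0 hf hxs horacle k0 mns mn'
  (masg_in_stage mu0 muL hf hxs halpha horacle s0 hq1 hq nsE hc0 k2 mns mn'))).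
rewrite lee_fin.
(* The lengths of the later stages form a geometric sum. *)
have NkE : (masg_N ns k <= ns 1 + 2 ^ k.+1 * c0)%N.
  case: k k0 {Nk1 Nk k2 m mn mns iterE mn'} => // j _; elim: j => [|j IHj].
    by rewrite NS /masg_N big_geq// add0n leq_addr.
  by rewrite NS nsE// [(2 ^ j.+3)%N]expnS mul2n -addnn mulnDl addnA leq_add2r.
(* With [n / C <= n / 2], the first stage is absorbed on the left, which doubles the constant 2 of
   the geometric sum. *)
have nle : n%:R <= 4 * (2 ^+ k * s) * (p + 3).
  have : n%:R <= n%:R / C + 2 * 2 ^+ k * c0%:R.
    rewrite -ns1E -exprS -natrX -natrM -natrD ler_nat.
    exact: leq_trans Nk NkE.
  have : 2 ^+ k * c0%:R <= 2 ^+ k * (s * (p + 3)).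
    by rewrite ler_wpM2l// exprn_ge0.
  lra.
have u0 : 0 < 2 ^+ k * s by rewrite mulr_gt0// exprn_gt0.
have uinv : (2 ^+ k * s)^-1 <= 4 * (p + 3) / n%:R.
  rewrite ler_pdivlMr// mulrC ler_pdivrMr//; lra.
have -> : n%:R / (C * s) = (ns 1%N)%:R / s by rewrite ns1E invfM mulrA.
have D0 : 0 <= f x00 - f xs by rewrite subr_ge0.
have ED0 := mulr_ge0 (expR_ge0 (- ((ns 1%N)%:R / s))) D0.
rewrite [leRHS]mulrDr lerD//.
  by rewrite -mulrA ler_wpM2r//; lra.
have V0 : 0 <= sigma ^+ 2 / mu by rewrite divr_ge0 ?sqr_ge0// ltW.
have -> : sigma ^+ 2 / (n%:R * mu) = sigma ^+ 2 / mu * n%:R^-1.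
  by rewrite invfM mulrA mulrAC.
have := ler_wpM2l V0 uinv; lra.
Qed.
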